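(* Let $R$ be a ring. The following statements are equivalent: (a) $R \cong M_{n}(D)$ for some division ring $D$ and some integer $n\ge 1$. (b) Every right $R$-module is weakly uniserial. (c) Every finitely generated right $R$-module is weakly uniserial. (d) Every $2$-generated right $R$-module is weakly uniserial. (e) Every injective right $R$-module is weakly uniserial. (f) The left-right symmetric versions of (b), (c), (d) and (e), that is: every left $R$-module is weakly uniserial; every finitely generated left $R$-module is weakly uniserial; every $2$-generated left $R$-module is weakly uniserial; every injective left $R$-module is weakly uniserial (each of these is equivalent to (a)).
   Context: Rings are associative with identity $1\neq 0$ (not necessarily commutative) and modules are unitary. A (right or left) module $M$ is called weakly uniserial if for any two submodules $N$ and $K$ of $M$ there exists an injective module homomorphism $N\to K$ or an injective module homomorphism $K\to N$. A module is $2$-generated if it can be generated by two elements. *)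

(* Defs.v *)
From mathcomp Require Import all_boot all_order all_algebra.

Set Implicit Arguments.
Unset Strict Implicit.
Unset Printing Implicit Defensive.

Import GRing.Theory.
Local Open Scope ring_scope.

(* [lmodType R] is the type of left R-modules, so right R-modules are
   [lmodType R^c], with R^c the converse ring of R. *)

(* A submodule of M is a predicate P with a [subLmodType P] on its elements. *)
Definition weakly_uniserial (R : nzRingType) (M : lmodType R) : Prop :=
  forall (P Q : pred M) (N : subLmodType P) (K : subLmodType Q),
    (exists f : {linear N -> K}, injective f) \/
    (exists f : {linear K -> N}, injective f).

Definition n_generated (R : nzRingType) (n : nat) (M : lmodType R) : Prop :=
  exists v : 'I_n -> M, forall x : M,
    exists c : 'I_n -> R, x = \sum_(i < n) c i *: v i.

Definition finitely_generated (R : nzRingType) (M : lmodType R) : Prop :=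
  exists n : nat, n_generated n M.

Definition injective_module (R : nzRingType) (E : lmodType R) : Prop :=
  forall (A B : lmodType R) (f : {linear A -> B}) (g : {linear A -> E}),
    injective f -> exists h : {linear B -> E}, forall x : A, h (f x) = g x.

Definition division_ring (D : unitRingType) : Prop :=
  forall x : D, x != 0 -> x \is a GRing.unit.

Definition ring_isomorphic (R S : pzRingType) : Prop :=
  exists f : {rmorphism R -> S}, bijective f.

(* Main.v *)
From HB Require Import structures.
Require Import Defs.
From mathcomp Require Import all_boot all_order all_algebra.
From mathcomp Require Import boolp classical_sets.

Set Implicit Arguments.
Unset Strict Implicit.
Unset Printing Implicit Defensive.

Import Order.TTheory GRing.Theory Num.Theory.
Local Open Scope ring_scope.

(* Everything goes through the left-right symmetric condition (S): R has an
   idempotent e such that eRe is a division ring and ReR = R.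

   (S) => (a): write 1 = a_1 s_1 + ... + a_n s_n with a_i in Re, s_i in eR and
   n minimal. Minimality makes the a_i independent over eRe, so s_i a_j is e
   or 0 and r |-> (s_i r a_j) is an isomorphism onto M_n(eRe).

   (S) => (b): given two modules, take a maximal isomorphism between submodules
   of each. If it is neither total nor onto, then vectors outside its domain
   and its codomain can be moved into the e-component, where they generate
   copies of Re, and the isomorphism extends.

   (d) => (S): for a maximal left ideal m, comparing R/m with R gives a minimal
   left ideal T. Let I be maximal among the left ideals meeting T trivially,
   and C = R/I. Since C has simple essential socle T, a comparison of C with
   T + T inside T + C makes C simple, so R = T + I and T = Re. If ReR were
   proper, e would kill R/ReR but not Re, and neither would embed in the other.

   (e) => (b): every module M embeds in an injective one, namely a product of
   copies of Hom_Z(R, Q/Z) indexed by Hom_Z(M, Q/Z). *)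

(** * Submodules and quotient modules *)

Section SubQuotient.
Variables (R : nzRingType) (M : lmodType R).

(* A itself, seen as a submodule of M with f as inclusion. *)
Definition embedded (A : lmodType R) (f : {linear A -> M})
  of injective f : Type := A.

Section Embedded.
Variables (A : lmodType R) (f : {linear A -> M}) (f_inj : injective f).

Definition in_range (x : M) : bool := `[< exists a, f a = x >].

Definition preimage_in_range (x : M) (xP : in_range x) : A :=
  sval (cid (asboolW xP)).

Lemma preimage_in_rangeK x (xP : in_range x) : f (preimage_in_range xP) = x.
Proof. exact: (svalP (cid (asboolW xP))). Qed.

Lemma embedded_rect (K : A -> Type) :
  (forall x (xP : in_range x), K (preimage_in_range xP)) -> forall a, K a.
Proof.
move=> K_sub a; have aP : in_range (f a) by apply/asboolP; exists a.
by rewrite -(f_inj (preimage_in_rangeK aP)).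
Qed.

HB.instance Definition _ := GRing.Lmodule.on (embedded f_inj).
HB.instance Definition _ := isSub.Build M in_range (embedded f_inj)
  embedded_rect preimage_in_rangeK.
HB.instance Definition _ := GRing.isSubZmodule.Build M in_range
  (embedded f_inj) (raddfB f).
HB.instance Definition _ := GRing.isSubLmodule.Build R M in_range
  (embedded f_inj) (linearZZ f).

End Embedded.
(** Since [embedded] is [A] itself as a type, the map that the hypothesis provides is already one
    between [A] and [B]. *)
Lemma weakly_uniserial_embed (A B : lmodType R)
    (f : {linear A -> M}) (g : {linear B -> M}) :
  weakly_uniserial M -> injective f -> injective g ->
  (exists h : {linear A -> B}, injective h) \/
  (exists h : {linear B -> A}, injective h).
Proof.
move=> wuM f_inj g_inj.
exact: (wuM _ _ (embedded f_inj) (embedded g_inj)).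
Qed.

Section Sub.
Variables (P : {pred M}) (P_closed : submod_closed P).

(** The closure proof is a parameter of the type, so that the module instance can be found from the
    type alone. *)
Definition submodule of submod_closed P : Type := {x : M | x \in P}.

HB.instance Definition _ := SubChoice.on (submodule P_closed).
HB.instance Definition _ := GRing.SubChoice_isSubLmodule.Build R M
  [in P] (submodule P_closed) (GRing.submod_closed_semi P_closed).
End Sub.

Lemma submodule_exists (P : {pred M}) : submod_closed P ->
  exists (N : lmodType R) (f : {linear N -> M}),
    injective f /\ (forall x, x \in P <-> exists y, f y = x).
Proof.
move=> P_closed; exists (submodule P_closed : lmodType R).
exists ((val : submodule P_closed -> M) : {linear submodule P_closed -> M}).
split; first exact: val_inj.
move=> x; split=> [xP|[y <-]]; last exact: (valP y).
by exists (Sub x xP : submodule P_closed); apply: SubK.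
Qed.


Section Quotient.
Variables (P : {pred M}) (P_closed : submod_closed P).

Definition submod_pred of submod_closed P : {pred M} := P.

HB.instance Definition _ := GRing.isSubmodClosed.Build R M
  (submod_pred P_closed) P_closed.

Definition quotient_module : Type := {ideal_quot submod_pred P_closed}.

HB.instance Definition _ := GRing.Zmodule.on quotient_module.

Local Notation proj := (\pi_{ideal_quot submod_pred P_closed}%qT
  : M -> quotient_module).

Definition quotient_scale (a : R) (x : quotient_module) : quotient_module :=
  proj (a *: repr x).

Lemma quotient_projB : {morph proj : x y / x - y}.
Proof. exact: raddfB. Qed.

Lemma quotient_proj_eq0 x : (proj x == 0) = (x \in P).
Proof.
rewrite -(raddf0 proj) -[RHS]/(x \in submod_pred P_closed) -[in RHS](subr0 x).
by rewrite Quotient.idealrBE.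
Qed.

(** Scaling a representative is well defined: [x] and the representative of its class differ by an
    element of [P], which is stable under scaling. *)
Lemma quotient_projZ a x : proj (a *: x) = quotient_scale a (proj x).
Proof.
apply/eqP; rewrite -subr_eq0 -quotient_projB quotient_proj_eq0 -scalerBr.
have xP : x - repr (proj x) \in P.
  by rewrite -quotient_proj_eq0 quotient_projB reprK subrr.
exact: (rpredZ (s := submod_pred P_closed) a xP).
Qed.

Lemma quotient_proj_surj (y : quotient_module) : exists x, proj x = y.
Proof. by exists (repr y); exact: reprK. Qed.

Lemma quotient_scaleA a b x :
  quotient_scale a (quotient_scale b x) = quotient_scale (a * b) x.
Proof.
by have [y <-] := quotient_proj_surj x; rewrite -!quotient_projZ scalerA.
Qed.

Lemma quotient_scale1 : left_id 1 quotient_scale.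
Proof.
move=> x; have [y <-] := quotient_proj_surj x.
by rewrite -quotient_projZ scale1r.
Qed.

Lemma quotient_scaleDr : right_distributive quotient_scale +%R.
Proof.
move=> a x y; have [u <-] := quotient_proj_surj x.
have [v <-] := quotient_proj_surj y.
by rewrite -(raddfD proj) -!quotient_projZ scalerDr (raddfD proj).
Qed.

Lemma quotient_scaleDl x : {morph quotient_scale^~ x : a b / a + b}.
Proof.
move=> a b; have [y <-] := quotient_proj_surj x.
by rewrite -!quotient_projZ scalerDl (raddfD proj).
Qed.

HB.instance Definition _ := GRing.Zmodule_isLmodule.Build R quotient_module
  quotient_scaleA quotient_scale1 quotient_scaleDr quotient_scaleDl.

Lemma quotient_proj_linear : linear proj.
Proof.
move=> a x y; rewrite (raddfD proj); congr (_ + _); exact: quotient_projZ.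
Qed.

HB.instance Definition _ := GRing.isLinear.Build R M quotient_module *:%R proj
  quotient_proj_linear.

End Quotient.

Lemma quotient_exists (P : {pred M}) : submod_closed P ->
  exists (Q : lmodType R) (f : {linear M -> Q}),
    (forall y, exists x, f x = y) /\ (forall x, f x = 0 <-> x \in P).
Proof.
move=> P_closed; exists (quotient_module P_closed : lmodType R).
exists ((\pi_{ideal_quot submod_pred P_closed}%qT
    : M -> quotient_module P_closed)
  : {linear M -> quotient_module P_closed}); split=> [|x].
  exact: quotient_proj_surj.
by rewrite -(quotient_proj_eq0 P_closed); split=> /eqP.
Qed.
End SubQuotient.

(** * Maximal submodules and linear maps given by their graphs *)

Lemma zero_submod_closed (R : nzRingType) (M : lmodType R) :
  submod_closed (pred1 (0 : M)).
Proof.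
by split=> [|a u v]; rewrite !inE // => /eqP-> /eqP->; rewrite scaler0 addr0.
Qed.

Lemma principal_submod_closed (R : nzRingType) (t : R) :
  @submod_closed R R^o (fun x => `[< exists a, x = a * t >]).
Proof.
split=> [|a u v /asboolP[b ->] /asboolP[c ->]]; apply/asboolP.
  by exists 0; rewrite mul0r.
by exists (a * b + c); rewrite mulrDl -mulrA.
Qed.

(** Zorn's lemma; the last clause is maximality, since adjoining [x] to [P] must meet [X]. Suitable
    [X] yield maximal left ideals, relative complements and, inside a product, maximal partial maps
    or partial isomorphisms. *)
Lemma maximal_avoiding_submodule (R : nzRingType) (M : lmodType R)
    (P0 : {pred M}) (X : M -> Prop) :
  submod_closed P0 -> (forall x, x \in P0 -> ~ X x) ->
  exists P : {pred M},
    [/\ submod_closed P, {subset P0 <= P}, forall x, x \in P -> ~ X x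
      & forall x, x \notin P -> exists a y, y \in P /\ X (a *: x + y)].
Proof.
move=> P0_closed P0X.
(* Adding [P0] to every set makes the union of the empty chain admissible too. *)
pose hull (A : set M) : {pred M} := fun x => `[< A x >] || (x \in P0).
have hullE A x : (x \in hull A) = `[< A x >] || (x \in P0) by [].
pose good A := submod_closed (hull A) /\ forall x, x \in hull A -> ~ X x.
have [|A [[A_closed AX] Amax]] := @Zorn_bigcup M good.
  move=> F Fgood Ftotal.
  (* Two elements of the hull of the union already lie in the hull of a single good set, where
     closure can be checked. *)
  have chain x y : x \in hull (\bigcup_(A in F) A)%classic ->
      y \in hull (\bigcup_(A in F) A)%classic ->
      exists A, [/\ good A, x \in hull A, y \in hull A &
        {subset hull A <= hull (\bigcup_(A in F) A)%classic}].
    have subF A : F A -> {subset hull A <= hull (\bigcup_(A in F) A)%classic}.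
      move=> FA z; rewrite !hullE => /orP[/asboolP Az|->]; last by rewrite orbT.
      by apply/orP; left; apply/asboolP; exists A.
    rewrite !hullE => /orP[/asboolP[A FA Ax]|Px] /orP[/asboolP[B FB By]|Py].
    - have [AB|BA] := Ftotal _ _ FA FB.
        exists B; split; [exact: Fgood| | |exact: subF]; rewrite hullE.
          by apply/orP; left; apply/asboolP/AB.
        by apply/orP; left; apply/asboolP.
      exists A; split; [exact: Fgood| | |exact: subF]; rewrite hullE.
        by apply/orP; left; apply/asboolP.
      by apply/orP; left; apply/asboolP/BA.
    - exists A; split; [exact: Fgood| | |exact: subF];
        rewrite hullE ?Py ?orbT //.
      by apply/orP; left; apply/asboolP.
    - exists B; split; [exact: Fgood| | |exact: subF];
        rewrite hullE ?Px ?orbT //.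
      by apply/orP; left; apply/asboolP.
    - exists set0; have hull0 z : (z \in hull set0) = (z \in P0).
        by rewrite hullE; case: asboolP.
      rewrite !hull0; split=> //; last first.
        by move=> z; rewrite hull0 hullE => ->; rewrite orbT.
      split=> [|z]; last by rewrite hull0; exact: P0X.
      split=> [|a u v]; rewrite !hull0; first exact: P0_closed.1.
      exact: P0_closed.2.
  split; last first.
    by move=> x Fx; have [A [[_ AX] Ax _ _]] := chain x x Fx Fx; exact: AX.
  split=> [|a u v Fu Fv]; first by rewrite hullE P0_closed.1 orbT.
  by have [A [[A_closed _] Au Av]] := chain u v Fu Fv; apply; apply: A_closed.2.
exists (hull A); split=> //.
  by move=> x; rewrite hullE => ->; rewrite orbT.
move=> x Ax; apply/not_existsP => noX.
(* [B] is the submodule generated by [x] and [hull A]; avoiding [X], it would contradict the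
   maximality of [A]. *)
pose B : set M := [set z | exists a y, y \in hull A /\ z = a *: x + y]%classic.
have hullB z : z \in hull B -> B z.
  rewrite hullE => /orP[/asboolP //|Pz].
  by exists 0, z; rewrite scale0r add0r hullE Pz orbT.
apply: (Amax B).
- split=> [z Az|BA].
    exists 0, z; rewrite scale0r add0r hullE; split=> //.
    by apply/orP; left; apply/asboolP.
  case/negP: Ax; rewrite hullE; apply/orP; left; apply/asboolP/BA.
  by exists 1, 0; rewrite addr0 scale1r A_closed.1.
- split=> [|z /hullB[a [y [Ay ->]]] Xz]; last by apply: (noX a); exists y.
  split=> [|a u v /hullB[b [y [Ay ->]]] /hullB[c [z [Az ->]]]].
    by rewrite hullE P0_closed.1 orbT.
  rewrite hullE; apply/orP; left; apply/asboolP.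
  exists (a * b + c), (a *: y + z); split; first exact: A_closed.2.
  by rewrite scalerDr scalerDl scalerA addrACA.
Qed.

Definition linear_map (R : nzRingType) (A B : lmodType R) (f : A -> B)
    (f_lin : linear f) : {linear A -> B} :=
  HB.pack_for {linear A -> B} f (GRing.isLinear.Build R A B *:%R f f_lin).

(** Any choice of values is linear: closure of [G] puts the defect of linearity in a pair [(0, y)]
    of [G], so it vanishes. *)
Lemma linear_of_graph (R : nzRingType) (A B : lmodType R)
    (G : {pred A * B}) :
  submod_closed G -> (forall y, (0, y) \in G -> y = 0) ->
  (forall x, exists y, (x, y) \in G) ->
  exists f : {linear A -> B}, forall x, (x, f x) \in G.
Proof.
move=> G_closed G_fun G_total; pose f x := sval (cid (G_total x)).
have Gf x : (x, f x) \in G by exact: svalP (cid (G_total x)).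
have f_lin : linear f.
  move=> a x y; apply/eqP; rewrite -subr_eq0; apply/eqP/G_fun.
  rewrite -(subrr (a *: x + y)).
  apply: ((GRing.submod_closedB G_closed).2 (_, _) (_, _) (Gf _)).
  exact: (G_closed.2 a (x, _) (y, _) (Gf x) (Gf y)).
by exists (linear_map f_lin).
Qed.

(* In the second clause y may be replaced by eye, so it says that eRe is a
   division ring; the third one says that ReR = R. *)
Definition full_division_idempotent (R : nzRingType) (e : R) : Prop :=
  [/\ e * e = e,
      forall x, e * x * e != 0 ->
        exists y, y * (e * x * e) = e /\ e * x * e * y = e
    & exists l : seq (R * R), 1 = \sum_(p <- l) p.1 * e * p.2].

(** Applied to [R^c] this also gives the reverse implication, because [R^c^c] is convertible to
    [R]. *)
Lemma full_division_idempotentC (R : nzRingType) (e : R) :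
  @full_division_idempotent R^c e -> full_division_idempotent e.
Proof.
move=> [ee ediv [l le]]; split=> // [x|].
  by rewrite -mulrA => /ediv[y [ye ey]]; exists y.
exists [seq (p.2, p.1) | p <- l]; rewrite big_map [LHS]le.
by apply: eq_bigr => p _; rewrite -mulrA.
Qed.

(** * Comparing modules over a ring with a full division idempotent *)

Lemma simple_isotypic_embed (R : nzRingType) (e : R) (N K : lmodType R) :
  full_division_idempotent e ->
  (exists f : {linear N -> K}, injective f) \/
  (exists f : {linear K -> N}, injective f).
Proof.
move=> [ee ediv [l le]].
(* The left ideal Re is simple: as ReR = R, a nonzero [r * e] has a nonzero left multiple in eRe,
   which is invertible there. *)
have ediv' r : r * e != 0 -> exists s, s * r * e = e.
  move=> re0; have [p pl ere0] : exists2 p, p \in l & e * (p.2 * r) * e != 0.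
    apply: contrapT => no_p; case/eqP: re0.
    rewrite -[r]mul1r le !mulr_suml big1_seq // => p /andP[_ pl].
    have -> : p.1 * e * p.2 * r * e = p.1 * (e * (p.2 * r) * e).
      by rewrite !mulrA.
    have [-> |nz] := eqVneq (e * (p.2 * r) * e) 0; first by rewrite mulr0.
    by case: no_p; exists p.
  have [y [ye _]] := ediv _ ere0.
  by exists (y * (e * p.2)); rewrite -[RHS]ye !mulrA.
(* If all [(e * s) *: x] were in [P], then so would be [x], by the expansion of 1 in ReR. *)
have efull (A : lmodType R) (P : {pred A}) x : submod_closed P ->
    x \notin P -> exists s, (e * s) *: x \notin P.
  move=> P_closed xP; apply: contrapT => no_s; case/negP: xP.
  rewrite -[x]scale1r le scaler_suml.
  have PS := GRing.isSubmodClosed.Build R A P P_closed.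
  pose P' : submodClosed A := HB.pack_for (submodClosed A) P PS.
  apply: (rpred_sum (S := P')) => p _; rewrite -mulrA -scalerA.
  apply: (rpredZ (s := P')); apply: contrapT => /negP nP; apply: no_s.
  by exists p.2.
(* A submodule of [N * K] without pairs having exactly one zero coordinate is the graph of an
   isomorphism between a submodule of [N] and one of [K]. *)
pose X (p : N * K) := (p.1 = 0 /\ p.2 != 0) \/ (p.2 = 0 /\ p.1 != 0).
have [|G [G_closed _ GX Gmax]] := maximal_avoiding_submodule (X := X)
  (zero_submod_closed (N * K)%type).
  by move=> x; rewrite !inE => /eqP->; case=> [][_]; rewrite eqxx.
have G_fun y : (0, y) \in G -> y = 0.
  by move=> /GX Xy; apply/eqP/negPn/negP => y0; apply: Xy; left.
have G_inj x : (x, 0) \in G -> x = 0.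
  by move=> /GX Xx; apply/eqP/negPn/negP => x0; apply: Xx; right.
pose dom x := `[< exists y, (x, y) \in G >].
pose cod y := `[< exists x, (x, y) \in G >].
have dom_closed : submod_closed (dom : {pred N}).
  split=> [|a u v /asboolP[y uy] /asboolP[z vz]]; apply/asboolP.
    by exists 0; exact: G_closed.1.
  by exists (a *: y + z); exact: (G_closed.2 a (u, y) (v, z)).
have cod_closed : submod_closed (cod : {pred K}).
  split=> [|a u v /asboolP[y uy] /asboolP[z vz]]; apply/asboolP.
    by exists 0; exact: G_closed.1.
  by exists (a *: y + z); exact: (G_closed.2 a (y, u) (z, v)).
have [dom_full|/existsNP[x /asboolPn xdom]] :=
  pselect (forall x, exists y, (x, y) \in G).
  left; have [f Gf] := linear_of_graph G_closed G_fun dom_full.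
  exists f => u v fuv; apply/eqP; rewrite -subr_eq0; apply/eqP/G_inj.
  rewrite -(subrr (f u)) {2}fuv.
  exact: ((GRing.submod_closedB G_closed).2 (_, _) (_, _) (Gf u) (Gf v)).
have [cod_full|/existsNP[y /asboolPn ycod]] :=
  pselect (forall y, exists x, (x, y) \in G).
  right; pose H : {pred K * N} := fun p => (p.2, p.1) \in G.
  have H_closed : submod_closed H.
    split=> [|a u v]; first exact: G_closed.1.
    exact: (G_closed.2 a (u.2, u.1) (v.2, v.1)).
  have [f Hf] := linear_of_graph H_closed G_inj cod_full.
  exists f => u v fuv; apply/eqP; rewrite -subr_eq0; apply/eqP/G_fun.
  rewrite -(subrr (f u)) {2}fuv.
  exact: ((GRing.submod_closedB G_closed).2 (_, _) (_, _) (Hf u) (Hf v)).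
have [s us] := efull _ _ _ dom_closed xdom; set u := _ *: x in us.
have [t vt] := efull _ _ _ cod_closed ycod; set v := _ *: y in vt.
(* If [a * e] were nonzero, a left multiple of it would be [e], and [(e * c) *: z] could be
   recovered in [P]. *)
have simple_gen (A : lmodType R) (P : {pred A}) z c a : submod_closed P ->
    (e * c) *: z \notin P -> a *: ((e * c) *: z) \in P -> a * e = 0.
  move=> P_closed zP az; apply/eqP/negPn/negP => /ediv'[b be]; case/negP: zP.
  rewrite -be -[b * a * e * c]mulrA -[(b * a) * _]mulrA -scalerA -scalerA.
  rewrite -[_ *: _]addr0.
  exact: P_closed.2 az P_closed.1.
(* Adjoining [(u, v)] creates a forbidden pair [a *: (u, v) + (g, h)]. Its zero coordinate puts
   [a *: u] in the domain or [a *: v] in the codomain, so [a * e = 0]; then [(g, h)] itself is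
   forbidden. *)
have [|a [[g h] [Ggh Xgh]]] := Gmax (u, v).
  by apply: contra us => Guv; apply/asboolP; exists v.
have ae : a * e = 0.
  case: Xgh => -[/= /eqP]; rewrite addr_eq0 => /eqP agh _.
    apply: (simple_gen _ _ _ _ _ dom_closed us); rewrite agh -sub0r.
    apply: (GRing.submod_closedB dom_closed).2; first exact: dom_closed.1.
    by apply/asboolP; exists h.
  apply: (simple_gen _ _ _ _ _ cod_closed vt); rewrite agh -sub0r.
  apply: (GRing.submod_closedB cod_closed).2; first exact: cod_closed.1.
  by apply/asboolP; exists g.
have au : a *: u = 0 by rewrite /u scalerA mulrA ae mul0r scale0r.
have av : a *: v = 0 by rewrite /v scalerA mulrA ae mul0r scale0r.
by case: (GX _ Ggh); move: Xgh; rewrite /X /= au av !add0r.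
Qed.

(** * From 2-generated modules to a full division idempotent *)

Section TwoGenerated.
Variable R : nzRingType.
Hypothesis wu2 : forall M : lmodType R, n_generated 2 M -> weakly_uniserial M.

Definition cyclic_by (C : lmodType R) (c : C) : Prop :=
  forall x, exists a, x = a *: c.

Lemma weakly_uniserial_pair (C D : lmodType R) (c : C) (d : D) :
  cyclic_by c -> cyclic_by d -> weakly_uniserial (C * D)%type.
Proof.
move=> C_cyc D_cyc; apply: wu2.
exists (fun i : 'I_2 => if i == ord0 then (c, 0) else (0, d)) => -[x y].
have [[a ->] [b ->]] := (C_cyc x, D_cyc y).
exists (fun i => if i == ord0 then a else b).
rewrite !big_ord_recl big_ord0 /= addr0.
by congr pair; rewrite /= scaler0 ?addr0 ?add0r.
Qed.

Lemma cyclic_embed (C D : lmodType R) (c : C) (d : D) :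
  cyclic_by c -> cyclic_by d ->
  (exists f : {linear C -> D}, injective f) \/
  (exists f : {linear D -> C}, injective f).
Proof.
move=> C_cyc D_cyc; have wuCD := weakly_uniserial_pair C_cyc D_cyc.
have inl_lin : linear (fun x : C => (x, 0 : D)).
  by move=> a x y; congr pair; rewrite /= scaler0 addr0.
have inr_lin : linear (fun y : D => (0 : C, y)).
  by move=> a x y; congr pair; rewrite /= scaler0 addr0.
apply: (weakly_uniserial_embed (f := linear_map inl_lin)
  (g := linear_map inr_lin) wuCD); by move=> x y [].
Qed.

(** If the simple module R/m embeds in R, the image of the class of 1 is [t]. If R embeds in R/m,
    then R itself is simple and [t = 1]. *)
Lemma minimal_left_ideal_exists :
  exists2 t : R, t != 0 & forall r, r * t != 0 -> exists s, s * (r * t) = t.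
Proof.
have [|m [m_closed _ m1 mmax]] := maximal_avoiding_submodule (X := eq 1)
  (zero_submod_closed R^o).
  by move=> x; rewrite inE => /eqP-> /eqP; rewrite oner_eq0.
have [S [p [p_surj p0]]] := quotient_exists m_closed.
have S_cyc : cyclic_by (p 1).
  move=> x; have [y <-] := p_surj x; exists y.
  by rewrite -linearZ; congr (p _); exact/esym/mulr1.
have R_cyc : cyclic_by (1 : R^o) by move=> x; exists x; exact/esym/mulr1.
have p1 : p 1 != 0 by apply/eqP => /p0/m1.
have S_simple (x : S) : x != 0 -> exists a, a *: x = p 1.
  have [y <-] := p_surj x => py0.
  have [|a [z [mz E]]] := mmax y.
    by apply: contra py0 => /p0->.
  by exists a; rewrite E linearD linearZ /= (p0 z).2 ?addr0.
have [[f f_inj]|[f f_inj]] := cyclic_embed S_cyc R_cyc.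
  exists (f (p 1)); first by rewrite raddf_eq0.
  move=> r; rewrite -[_ * _]/(r *: f (p 1)) -linearZ raddf_eq0 // => rp.
  have [s sp] := S_simple _ rp.
  by exists s; rewrite -[RHS](congr1 f sp) !linearZ.
exists 1; first exact: oner_neq0.
move=> r; rewrite mulr1 => r0.
have [|s sE] := S_simple (f r); first by rewrite raddf_eq0.
have [b fb] := S_cyc (f 1).
exists (b * s); apply: f_inj; rewrite fb -sE -!linearZ; congr (f _).
by rewrite scalerA.
Qed.

Lemma minimal_idempotent_exists :
  exists e : R, [/\ e != 0, e * e = e
    & forall r, r * e != 0 -> exists s, s * (r * e) = e].
Proof.
have [t t0 t_min] := minimal_left_ideal_exists.
pose T : {pred R^o} := fun x => `[< exists a, x = a * t >].
pose X x := x \in T /\ x != 0.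
have T_closed : submod_closed T by exact: principal_submod_closed t.
have [|I [I_closed _ IX Imax]] := maximal_avoiding_submodule (X := X)
  (zero_submod_closed R^o).
  by move=> x; rewrite inE => /eqP-> []; rewrite eqxx.
have [C [p [p_surj p0]]] := quotient_exists I_closed.
have [S [i [i_inj iT]]] := submodule_exists T_closed.
have i0 x : (i x == 0) = (x == 0) by exact: raddf_eq0.
have [t' it] : exists t', i t' = t by apply/iT/asboolP; exists 1; rewrite mul1r.
have S_cyc : cyclic_by t'.
  move=> x; have /asboolP[a xa] : i x \in T by apply/iT; exists x.
  by exists a; apply: i_inj; rewrite linearZ /= it.
have S_simple (x : S) : x != 0 -> forall y, exists a, a *: x = y.
  have [a -> at0] := S_cyc x => y; have [b ->] := S_cyc y.
  have [|s st] := t_min a.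
    by move: at0; rewrite -i0 linearZ /= it.
  exists (b * s); rewrite -scalerA; congr (_ *: _).
  by apply: i_inj; rewrite !linearZ /= it.
have t'0 : t' != 0 by rewrite -i0 it.
(* As [I] meets [T] trivially, [T] embeds in [C]. *)
have pi_inj x : p (i x) = 0 -> x = 0.
  move/p0 => Iix; apply: contrapT => /eqP x0; apply: (IX _ Iix); split.
    by apply/iT; exists x.
  by rewrite raddf_eq0.
have C_cyc : cyclic_by (p 1).
  move=> x; have [y <-] := p_surj x; exists y.
  by rewrite -linearZ; congr (p _); exact/esym/mulr1.
(* [p (i S)] is essential in [C]. *)
have C_ess (x : C) : x != 0 -> forall y, exists a, a *: x = p (i y).
  have [z <- pz] := p_surj x => y.
  have [|a [w [Iw [/iT[v vE] zw0]]]] := Imax z.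
    by apply: contra pz => /p0->.
  have [|b bv] := S_simple v _ y.
    by rewrite -i0 vE.
  exists (b * a); rewrite -scalerA -bv -linearZ !linearZ /= vE linearD /=.
  by rewrite (p0 w).2 // addr0 linearZ.
(* A map to the simple module that is nonzero on the essential socle is injective. Choosing [s] so
   that [q] kills the class of [1 - s * t] thus puts that element in [I]. *)
have split_of_map (q : C -> S) : linear q -> q (p (i t')) != 0 ->
    exists s, 1 - s * t \in I.
  move=> q_lin; pose ql := linear_map q_lin; rewrite -[q]/(ql : _ -> _) => qt.
  have [s sE] := S_simple _ qt (ql (p 1)); exists s; apply/p0.
  rewrite linearB -[s * t]/(s *: (t : R^o)) linearZ -it /=.
  apply: contrapT => /eqP z0; case/eqP: qt.
  have [a <-] := C_ess _ z0 t'.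
  by rewrite linearZ linearB linearZ /= sE subrr scaler0.
have [s Is] : exists s, 1 - s * t \in I.
  have j1_lin : linear (fun x : C => (0 : S, x)).
    by move=> a x y; congr pair; rewrite /= scaler0 addr0.
  have j2_lin : linear (fun x : S * S => (x.1, p (i x.2))).
    by move=> a x y; congr pair; rewrite /= !linearP.
  have [|||] := weakly_uniserial_embed (f := linear_map j1_lin)
      (g := linear_map j2_lin) (weakly_uniserial_pair S_cyc C_cyc).
  - by move=> x y [].
  - move=> [x1 x2] [y1 y2] [-> /eqP].
    rewrite -subr_eq0 -!linearB => /eqP/pi_inj/eqP.
    by rewrite subr_eq0 => /eqP->.
  (* [C] embeds in [S * S], and one of the two coordinates is nonzero on the socle. *)
  - case=> g g_inj.
    have : g (p (i t')) != 0.
      by rewrite raddf_eq0 //; apply: contra_neq t'0; exact: pi_inj.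
    rewrite -pair_eqE negb_and => /orP[] gt.
      apply: (split_of_map (fun x => (g x).1)) gt => a x y.
      by rewrite linearP.
    apply: (split_of_map (fun x => (g x).2)) gt => a x y.
    by rewrite linearP.
  (* [S * S] cannot embed in [C]: the images of both axes would contain the socle, although the axes
     meet trivially. *)
  case=> f f_inj; case/eqP: (t'0).
  have [|a aE] := C_ess (f (t', 0)) _ t'.
    by rewrite raddf_eq0 // -pair_eqE negb_and t'0.
  have [|b bE] := C_ess (f (0, t')) _ t'.
    by rewrite raddf_eq0 // -pair_eqE negb_and t'0 orbT.
  have /f_inj[at0 _] : f (a *: (t', 0)) = f (b *: (0, t')).
    by rewrite !linearZ /= aE bE.
  apply: pi_inj; rewrite -aE -linearZ -[RHS](linear0 f); congr (f _).
  by congr pair; rewrite /= ?at0 scaler0.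
pose e := s * t.
have e_min r : r * e != 0 -> exists s, s * (r * e) = e.
  rewrite mulrA => /t_min[b bt]; exists (s * b).
  by rewrite /e -[in RHS]bt !mulrA.
have e0 : e != 0.
  apply: contraNneq t0 => e0; move: Is; rewrite -/e e0 subr0 => I1.
  have It : t \in I.
    by rewrite -[t]mulr1 -[_ * _]addr0; exact: I_closed.2 I1 I_closed.1.
  by apply/eqP; rewrite -it (pi_inj t') ?linear0 // it; apply/p0.
(* The difference is [e * (1 - s * t)], hence in [I], and [(s - e * s) * t], hence in [T]. *)
have ee : e * e = e.
  apply/esym/eqP; rewrite -subr_eq0; apply: contrapT => /negP ee0.
  apply: (IX (e - e * e)); last split=> //.
    rewrite -[X in X - _]mulr1 -mulrBr -[_ * _]addr0.
    exact: I_closed.2 Is I_closed.1.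
  by apply/asboolP; exists (s - e * s); rewrite mulrBl -[e * s * t]mulrA.
by exists e.
Qed.
(** Minimality of Re only gives left inverses in eRe; they are two-sided because a left inverse has
    a left inverse in turn. That ReR = R follows by comparing R/ReR with Re. *)
Lemma full_division_idempotent_exists :
  exists e : R, full_division_idempotent e.
Proof.
have [e [e0 ee e_min]] := minimal_idempotent_exists.
exists e; split=> // [x xe0|].
  set w := e * x * e; have ew : e * w = w by rewrite /w !mulrA ee.
  have [s sw] : exists s, s * w = e by exact: e_min xe0.
  pose y := e * s * e.
  have yw : y * w = e by rewrite /y -mulrA ew -mulrA sw.
  have ey : e * y = y by rewrite /y !mulrA ee.
  have [|z zy] := e_min (e * s).
    apply: contra_neq e0; rewrite -/y -[X in _ -> X = _]yw => ->.
    exact: mul0r.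
  exists y; split=> //.
  have ze : z * e = w by rewrite -{1}yw mulrA zy ew.
  by rewrite -ze -mulrA ey.
pose J : {pred R^o} :=
  fun x => `[< exists l : seq (R * R), x = \sum_(p <- l) p.1 * e * p.2 >].
have J_closed : submod_closed J.
  split=> [|a u v /asboolP[k ->] /asboolP[l ->]]; apply/asboolP.
    by exists [::]; rewrite big_nil.
  exists ([seq (a * p.1, p.2) | p <- k] ++ l).
  rewrite big_cat big_map scaler_sumr; congr (_ + _).
  by apply: eq_bigr => p _; rewrite -[LHS]/(a * _) !mulrA.
have eJ r : e * r \in J.
  by apply/asboolP; exists [:: (1, r)]; rewrite big_seq1 mul1r.
apply: contrapT => J1.
have [S [p [p_surj p0]]] := quotient_exists J_closed.
have S_cyc : cyclic_by (p 1).
  move=> x; have [y <-] := p_surj x; exists y.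
  by rewrite -linearZ; congr (p _); exact/esym/mulr1.
have eS (x : S) : e *: x = 0.
  by have [y <-] := p_surj x; rewrite -linearZ; apply/p0/eJ.
pose T : {pred R^o} := fun x => `[< exists a, x = a * e >].
have T_closed : submod_closed T by exact: principal_submod_closed e.
have [N [i [i_inj iT]]] := submodule_exists T_closed.
have [t it] : exists t, i t = e by apply/iT/asboolP; exists 1; rewrite mul1r.
have t0 : t <> 0 by move=> t0; case/eqP: e0; rewrite -it t0 linear0.
have et : e *: t = t by apply: i_inj; rewrite linearZ /= it.
have N_cyc : cyclic_by t.
  move=> x; have /asboolP[a xa] : i x \in T by apply/iT; exists x.
  by exists a; apply: i_inj; rewrite linearZ /= it.
(* A nonzero image of [S] in the simple module [N] contains [t]; but [e] kills [S] and fixes [t].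
   The same clash excludes an embedding of [N] in [S]. *)
have [[f f_inj]|[f f_inj]] := cyclic_embed S_cyc N_cyc.
  have [a fa] := N_cyc (f (p 1)).
  have [|b bE] := e_min a.
    apply/eqP => ae0; apply/J1/asboolP/p0/f_inj; rewrite linear0 fa.
    by rewrite -et scalerA ae0 scale0r.
  have tE : t = f (b *: p 1).
    by rewrite linearZ /= fa -[LHS]et -bE -!scalerA et.
  by apply: t0; rewrite -et tE -linearZ eS linear0.
apply: t0; apply: f_inj.
by rewrite -et linearZ /= eS linear0.
Qed.

End TwoGenerated.

(** * Coinduced modules *)

Section Coinduced.
Variables (R : nzRingType) (D : zmodType) (X : Type).

(* The product over [X] of copies of Hom_Z(R, D). *)
Definition coinduced : Type :=
  {phi : X -> R -> D | forall x, {morph phi x : a b / a + b}}.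

HB.instance Definition _ := gen_eqMixin coinduced.
HB.instance Definition _ := gen_choiceMixin coinduced.

Implicit Types phi psi : coinduced.

Lemma coinduced_eq phi psi :
  (forall x a, sval phi x a = sval psi x a) -> phi = psi.
Proof.
move: phi psi => [phi ?] [psi ?] /= phi_psi; apply: eq_exist.
by apply: funext => x; apply: funext => a.
Qed.

Definition coinduced_zero : coinduced.
Proof. by exists (fun _ _ => 0) => x a b; rewrite addr0. Defined.

Definition coinduced_opp phi : coinduced.
Proof.
by exists (fun x a => - sval phi x a) => x a b; rewrite (svalP phi) opprD.
Defined.

Definition coinduced_add phi psi : coinduced.
Proof.
exists (fun x a => sval phi x a + sval psi x a) => x a b.
by rewrite (svalP phi) (svalP psi) addrACA.
Defined.

(** Multiplying the argument on the right is what makes this a left action. *)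
Definition coinduced_scale (c : R) phi : coinduced.
Proof.
by exists (fun x a => sval phi x (a * c)) => x a b; rewrite mulrDl (svalP phi).
Defined.

Lemma coinduced_addA : associative coinduced_add.
Proof. by move=> *; apply: coinduced_eq => x a; exact: addrA. Qed.

Lemma coinduced_addC : commutative coinduced_add.
Proof. by move=> *; apply: coinduced_eq => x a; exact: addrC. Qed.

Lemma coinduced_add0 : left_id coinduced_zero coinduced_add.
Proof. by move=> *; apply: coinduced_eq => x a; exact: add0r. Qed.

Lemma coinduced_addN :
  left_inverse coinduced_zero coinduced_opp coinduced_add.
Proof. by move=> *; apply: coinduced_eq => x a; exact: addNr. Qed.

HB.instance Definition _ := GRing.isZmodule.Build coinduced
  coinduced_addA coinduced_addC coinduced_add0 coinduced_addN.

Lemma coinduced_scaleA b c phi :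
  coinduced_scale b (coinduced_scale c phi) = coinduced_scale (b * c) phi.
Proof. by apply: coinduced_eq => x a; rewrite /= mulrA. Qed.

Lemma coinduced_scale1 : left_id 1 coinduced_scale.
Proof. by move=> phi; apply: coinduced_eq => x a; rewrite /= mulr1. Qed.

Lemma coinduced_scaleDr : right_distributive coinduced_scale +%R.
Proof. by move=> c phi psi; apply: coinduced_eq. Qed.

Lemma coinduced_scaleDl phi : {morph coinduced_scale^~ phi : b c / b + c}.
Proof.
by move=> b c; apply: coinduced_eq => x a; rewrite /= mulrDr (svalP phi).
Qed.

HB.instance Definition _ := GRing.Zmodule_isLmodule.Build R coinduced
  coinduced_scaleA coinduced_scale1 coinduced_scaleDr coinduced_scaleDl.

End Coinduced.

(** * Divisible groups and enough injectives; abelian groups appear as modules over [int] *)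

Definition divisible (D : lmodType int) : Prop :=
  forall (n : nat) (d : D), (0 < n)%N -> exists d', n%:Z *: d' = d.

(** Euclidean division by the least positive element; [n = 0] encodes the zero ideal. *)
Lemma int_submodule_principal (P : {pred int^o}) :
  submod_closed P -> exists n : nat, forall k : int, (k \in P) = (n %| k)%Z.
Proof.
move=> P_closed; have PM (k l : int) : l \in P -> k * l \in P.
  by move=> lP; rewrite -[k * l]addr0; exact: P_closed.2 k _ _ lP P_closed.1.
have PB := (GRing.submod_closedB P_closed).2.
have [P_pos|P_no_pos] := pselect (exists n, (0 < n)%N && (n%:Z \in P)).
  case: (ex_minnP P_pos) => n /andP[n0 nP] nmin; exists n => k.
  apply/idP/idP => [kP|/dvdzP[q ->]]; last exact: PM.
  have n0' : (0 < n%:Z)%R by rewrite ltz_nat.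
  have rP : (k %% n)%Z \in P by exact: PB kP (PM _ _ nP).
  rewrite (sameP dvdz_mod0P eqP).
  have := modz_ge0 k (lt0r_neq0 n0'); have := ltz_pmod k n0'.
  case: (k %% n)%Z rP => // -[//|r] rP; rewrite ltz_nat => rn.
  by have := nmin r.+1; rewrite rP => /(_ isT); rewrite leqNgt rn.
exists 0 => k; rewrite dvd0z; apply/idP/eqP => [|->]; last exact: P_closed.1.
case: k => [[|n]|n] // nP; case: P_no_pos; exists n.+1 => //.
have -> : n.+1%:Z = 0 - Negz n by rewrite sub0r NegzE opprK.
by rewrite PB // P_closed.1.
Qed.

(** Baer's argument on graphs: if [x] is outside the domain of a maximal extension, the multiples of
    [x] inside it are those by multiples of some [n], and dividing the value at [n *: x] by [n]
    gives an admissible value [d] at [x]. *)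
Lemma divisible_extend (B D : lmodType int) (G0 : {pred B * D}) :
  divisible D -> submod_closed G0 -> (forall y, (0, y) \in G0 -> y = 0) ->
  exists h : {linear B -> D}, forall x y, (x, y) \in G0 -> h x = y.
Proof.
move=> divD G0_closed G0_fun; pose X (p : B * D) := p.1 = 0 /\ p.2 != 0.
have [|G [G_closed G0G GX Gmax]] := maximal_avoiding_submodule
  (M := (B * D)%type) (X := X) G0_closed.
  by move=> [x y] + [/= x0]; rewrite x0 => /G0_fun->; rewrite eqxx.
have G_fun y : (0, y) \in G -> y = 0.
  by move=> /GX Xy; apply/eqP/negPn/negP => y0; apply: Xy.
have GB x y x' y' : (x, y) \in G -> (x', y') \in G -> (x - x', y - y') \in G.
  by move=> xG x'G; exact: (GRing.submod_closedB G_closed).2 xG x'G.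
have GZ k x y : (x, y) \in G -> (k *: x, k *: y) \in G.
  move=> xG; rewrite -[k *: x]addr0 -[k *: y]addr0.
  exact: G_closed.2 k _ (0, 0) xG G_closed.1.
have G_total x : exists y, (x, y) \in G.
  pose P : {pred int^o} := fun k => `[< exists y, (k *: x, y) \in G >].
  have [|n nP] := @int_submodule_principal P.
    split=> [|k l1 l2 /asboolP[y1 y1G] /asboolP[y2 y2G]]; apply/asboolP.
      by exists 0; rewrite scale0r G_closed.1.
    exists (k *: y1 + y2); rewrite scalerDl -[k *: l1]/(k * l1) -scalerA.
    exact: (G_closed.2 k (_, _) (_, _) y1G y2G).
  have [d dP] : exists d, forall k y, (k *: x, y) \in G -> y = k *: d.
    have /asboolP[y nxG] : (n : int) \in P by rewrite nP dvdzz.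
    have [d dE] : exists d, n%:Z *: d = y.
      (* For [n = 0] no nonzero multiple of [x] by an integer constrains the value, and 0 is
         taken. *)
      have [n0|n0] := posnP n; last exact: divD.
      by exists 0; rewrite scaler0; apply/esym/G_fun; rewrite n0 scale0r in nxG.
    exists d => k z kzG.
    have /dvdzP[q kE] : (n %| k)%Z by rewrite -nP; apply/asboolP; exists z.
    have := GB _ _ _ _ kzG (GZ q _ _ nxG).
    rewrite kE -scalerA subrr => /G_fun/eqP; rewrite subr_eq0 => /eqP->.
    by rewrite -scalerA dE.
  apply: contrapT => xG.
  have [|k [[g w] [Ggw [/= /eqP + /eqP]]]] := Gmax (x, d).
    by apply/negP => ?; apply: xG; exists d.
  rewrite addr_eq0 => /eqP kx; apply.
  rewrite -(dP k (- w)) ?addNr // kx -[- g]sub0r -[- w]sub0r.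
  exact: GB G_closed.1 Ggw.
have [h hP] := linear_of_graph G_closed G_fun G_total.
exists h => x y /G0G xyG; apply/eqP; rewrite -subr_eq0; apply/eqP/G_fun.
by rewrite -(subrr x); exact: GB.
Qed.

(** The group is Q/Z, in which the class of 1/n is nonzero and killed by n. *)
Lemma divisible_cogenerator_exists : exists D : lmodType int,
  divisible D /\
  forall n, (1 < n)%N -> exists2 d : D, d != 0 & n%:Z *: d = 0.
Proof.
pose P : {pred (zmodule rat)} := fun x : rat => x \is a Num.int.
have P_closed : submod_closed P.
  split=> [|k x y /intrP[m ->] /intrP[n ->]]; first exact: int_num0.
  by apply/intrP; exists (m * k + n); rewrite intrD mulrzA.
have [D [p [p_surj p0]]] := quotient_exists P_closed.
have natZ (n : nat) (x : rat) : n%:Z *: (x : zmodule rat) = n%:R * x.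
  by rewrite scalezrE -pmulrn mulr_natl.
exists D; split=> n.
  move=> d n0; have [x <-] := p_surj d.
  exists (p ((x : rat) / n%:R)); rewrite -linearZ; congr (p _).
  by rewrite /= natZ mulrCA divff ?mulr1 // pnatr_eq0 -lt0n.
move=> n1; have n0 : (n%:R : rat) != 0 by rewrite pnatr_eq0 -lt0n ltnW.
exists (p (n%:R^-1 : rat)).
  apply/eqP => /p0 /norm_intr_ge1; rewrite invr_eq0 => /(_ n0).
  by rewrite normfV normr_nat lt_geF // invf_lt1 ?ltr1n // ltr0n ltnW.
rewrite -linearZ; apply/p0; rewrite /= natZ divff //.
Qed.

(** By adjunction, an R-linear map into Hom_Z(R, D) amounts to an additive map into [D], obtained by
    evaluating at 1. The additive maps extend because [D] is divisible. *)
Lemma coinduced_injective (R : nzRingType) (D : lmodType int) (X : Type) :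
  divisible D -> injective_module (coinduced R D X).
Proof.
move=> divD A B f g f_inj.
pose G x : {pred zmodule B * D} :=
  fun p => `[< exists a, f a = p.1 /\ sval (g a) x 1 = p.2 >].
have gD x c : {morph (fun a => sval (g a) x c) : a b / a + b}.
  by move=> a b; rewrite raddfD.
have gB x c : zmod_morphism (fun a => sval (g a) x c).
  by move=> a b; rewrite raddfB.
have G_closed x : submod_closed (G x).
  split=> [|k [u1 u2] [v1 v2] /asboolP[a [/= <- <-]] /asboolP[b [/= <- <-]]].
    by apply/asboolP; exists 0; rewrite !linear0.
  apply/asboolP; exists (a *~ k + b); split; first by rewrite linearD raddfMz.
  rewrite gD /=; congr (_ + _).
  pose gx := GRing.isZmodMorphism.Build A D (fun a => sval (g a) x 1) (gB x 1).
  pose ga : {additive A -> D} :=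
    HB.pack_for {additive A -> D} (fun a => sval (g a) x 1) gx.
  by rewrite -[LHS]/(ga _) raddfMz -scaler_int intz.
have h_ex x :
    exists h : {linear zmodule B -> D}, forall a, h (f a) = sval (g a) x 1.
  have [|h hG] := divisible_extend divD (G_closed x).
    move=> y /asboolP[a [/= fa <-]].
    have -> : a = 0 by apply: f_inj; rewrite linear0.
    by rewrite linear0.
  by exists h => a; apply: hG; apply/asboolP; exists a.
pose h x := sval (cid (h_ex x)).
have hE x a : h x (f a) = sval (g a) x 1 by exact: (svalP (cid (h_ex x))).
have k_add (b : B) x : {morph (fun c : R => h x (c *: b)) : c d / c + d}.
  by move=> c d; rewrite scalerDl linearD.
pose k (b : B) : coinduced R D X :=
  exist _ (fun x (c : R) => h x (c *: b)) (k_add b).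
have k_lin : linear k.
  move=> c u v; apply: coinduced_eq => x d.
  by rewrite /= scalerDr scalerA linearD.
exists (linear_map k_lin) => a; apply: coinduced_eq => x c.
by rewrite /= -linearZ hE linearZ /= mul1r.
Qed.

(** The map sends [m] to the family of [c |-> x (c *: m)]. It is injective because every nonzero [m]
    has a nonzero image under some additive map to Q/Z, extended from the subgroup generated by
    [m]. *)
Lemma enough_injectives (R : nzRingType) (M : lmodType R) :
  exists (E : lmodType R) (f : {linear M -> E}),
    injective_module E /\ injective f.
Proof.
have [D [divD tors]] := divisible_cogenerator_exists.
pose X := {linear zmodule M -> D}.
have f_add (m : M) (x : X) : {morph (fun c : R => x (c *: m)) : c d / c + d}.
  by move=> c d; rewrite scalerDl linearD.
pose f (m : M) : coinduced R D X :=
  exist _ (fun (x : X) (c : R) => x (c *: m)) (f_add m).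
have f_lin : linear f.
  move=> c u v; apply: coinduced_eq => x d.
  by rewrite /= scalerDr scalerA linearD.
exists (coinduced R D X), (linear_map f_lin).
split; first exact: coinduced_injective.
suff f0 m : f m = 0 -> m = 0.
  move=> u v /eqP; rewrite -subr_eq0 -linearB => /eqP/f0/eqP.
  by rewrite subr_eq0 => /eqP.
move=> fm0; apply: contrapT => /eqP m0.
have x0 (x : X) : x m = 0.
  by have := congr1 (fun phi => sval phi x 1) fm0; rewrite /= scale1r.
have [d [d0 dP]] : exists d : D, d != 0 /\
    forall k : int, m *~ k = 0 -> k *: d = 0.
  pose P : {pred int^o} := fun k => m *~ k == 0.
  have PE k : (k \in P) = (m *~ k == 0) by [].
  have [|n nP] := @int_submodule_principal P.
    split=> [|k l1 l2]; first by rewrite PE mulr0z.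
    rewrite !PE => /eqP l1m /eqP l2m.
    by rewrite mulrzDr l2m addr0 -[k *: l1]/(k * l1) mulrC mulrzA l1m mul0rz.
  have [d d0 nd] : exists2 d : D, d != 0 & n%:Z *: d = 0.
    (* If [m] has infinite order, any nonzero [d] will do; [n = 1] would force [m = 0]. *)
    case: n nP => [|[|n]] nP; last exact: tors.
      by have [d d0 _] := tors 2 isT; exists d => //; exact: scale0r.
    by case/negP: m0; rewrite -[m]mulr1z -PE nP.
  exists d; split=> // k mk.
  have /dvdzP[q ->] : (n %| k)%Z by rewrite -nP PE mk.
  by rewrite -scalerA nd scaler0.
pose G : {pred zmodule M * D} :=
  fun p => `[< exists k : int, p = (m *~ k, k *: d) >].
have [||x xP] := @divisible_extend (zmodule M) D G divD.
- split=> [|k u v /asboolP[a ->] /asboolP[b ->]]; apply/asboolP.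
    by exists 0; rewrite mulr0z scale0r.
  exists (k * a + b); rewrite mulrzDr scalerDl -scalerA mulrC mulrzA.
  by [].
- by move=> y /asboolP[k [mk ->]]; exact: dP.
case/eqP: d0; rewrite -(xP m d) //; apply/asboolP.
by exists 1; rewrite mulr1z scale1r.
Qed.

(** * The corner ring eRe and the matrix ring over it *)

Section Corner.
Variables (R : nzRingType) (e : R).
Hypothesis e_full : full_division_idempotent e.

Let ee : e * e = e. Proof. by case: e_full. Qed.

Lemma full_idempotent_neq0 : e != 0.
Proof.
case: e_full => _ _ [l le]; apply: contra_neq (oner_neq0 R) => e0.
by rewrite le big1 // => p _; rewrite e0 mulr0 mul0r.
Qed.

Definition in_corner : {pred R} := fun x => e * x * e == x.

Lemma in_cornerP x : reflect (e * x = x /\ x * e = x) (x \in in_corner).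
Proof.
apply: (iffP eqP) => [<-|[-> ->] //].
by rewrite !mulrA ee -!mulrA ee.
Qed.

Lemma in_corner_zmod : zmod_closed in_corner.
Proof.
split=> [|x y]; first by rewrite unfold_in mulr0 mul0r.
by rewrite !unfold_in mulrBr mulrBl => /eqP-> /eqP->.
Qed.

HB.instance Definition _ := GRing.isZmodClosed.Build R in_corner in_corner_zmod.

Definition corner of full_division_idempotent e : Type := {x | x \in in_corner}.

Local Notation D := (corner e_full).

HB.instance Definition _ := SubChoice.on D.
HB.instance Definition _ := [SubChoice_isSubZmodule of D by <:].

Lemma corner_e : e \in in_corner.
Proof. by apply/in_cornerP. Qed.

Lemma corner_compress x : e * x * e \in in_corner.
Proof. by apply/in_cornerP; rewrite !mulrA ee -!mulrA ee. Qed.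

Lemma cornerP (x : D) : e * val x = val x /\ val x * e = val x.
Proof. exact/in_cornerP/(valP x). Qed.

Lemma in_cornerM (x y : D) : val x * val y \in in_corner.
Proof.
have [[ex _] [_ ye]] := (cornerP x, cornerP y).
by apply/in_cornerP; rewrite mulrA ex -mulrA ye.
Qed.

Definition corner_one : D := Sub e corner_e.
Definition corner_mul (x y : D) : D := Sub (val x * val y) (in_cornerM x y).

Lemma corner_mulA : associative corner_mul.
Proof. by move=> x y z; apply: val_inj; rewrite !SubK mulrA. Qed.

Lemma corner_mul1 : left_id corner_one corner_mul.
Proof. by move=> x; apply: val_inj; rewrite !SubK (cornerP x).1. Qed.

Lemma corner_1mul : right_id corner_one corner_mul.
Proof. by move=> x; apply: val_inj; rewrite !SubK (cornerP x).2. Qed.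

Lemma corner_mulDl : left_distributive corner_mul +%R.
Proof. by move=> x y z; apply: val_inj; exact: mulrDl. Qed.

Lemma corner_mulDr : right_distributive corner_mul +%R.
Proof. by move=> x y z; apply: val_inj; exact: mulrDr. Qed.

Lemma corner_one_neq0 : corner_one != 0.
Proof.
apply/negP => /eqP/(congr1 val)/eqP.
by rewrite SubK raddf0 (negPf full_idempotent_neq0).
Qed.

HB.instance Definition _ := GRing.Zmodule_isNzRing.Build D
  corner_mulA corner_mul1 corner_1mul corner_mulDl corner_mulDr corner_one_neq0.

Lemma corner_valM (x y : D) : val (x * y) = val x * val y.
Proof. exact: SubK. Qed.

Lemma corner_val1 : val (1 : D) = e.
Proof. exact: SubK. Qed.

(** The clause for 0 fixes the default inverse, since the ring structure demands that inversion be
    the identity on non-units. *)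
Lemma corner_inv_ex (x : D) :
  exists y : D, (x = 0 -> y = 0) /\ (x != 0 -> y * x = 1 /\ x * y = 1).
Proof.
have [->|x0] := eqVneq x 0; first by exists 0.
have [ex xe] := cornerP x.
have [_ /(_ (val x)) + _] := e_full; rewrite ex xe => /(_ x0) [y [yx xy]].
exists (Sub (e * y * e) (corner_compress y)); split=> [x_eq0|_].
  by rewrite x_eq0 eqxx in x0.
split; apply: val_inj; rewrite corner_valM SubK corner_val1.
  by rewrite -mulrA ex -mulrA yx ee.
by rewrite !mulrA xe xy ee.
Qed.

Definition corner_inv (x : D) : D :=
  sval (cid (corner_inv_ex x)).

Lemma corner_invP (x : D) :
  x != 0 -> corner_inv x * x = 1 /\ x * corner_inv x = 1.
Proof.
exact: (svalP (cid (corner_inv_ex x))).2.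
Qed.

Lemma corner_mulV : {in [pred x : D | x != 0], left_inverse 1 corner_inv *%R}.
Proof. by move=> x /corner_invP[]. Qed.

Lemma corner_Vmul : {in [pred x : D | x != 0], right_inverse 1 corner_inv *%R}.
Proof. by move=> x /corner_invP[]. Qed.

Lemma corner_unit (x y : D) : y * x = 1 /\ x * y = 1 -> x != 0.
Proof.
by move=> [yx _]; apply: contra_eq_neq yx => ->; rewrite mulr0 eq_sym oner_eq0.
Qed.

Lemma corner_inv_out : {in [predC [pred x : D | x != 0]], corner_inv =1 id}.
Proof.
move=> x; rewrite !inE negbK => /eqP->.
exact: (svalP (cid (corner_inv_ex 0))).1 erefl.
Qed.

HB.instance Definition _ := GRing.NzRing_hasMulInverse.Build D
  corner_mulV corner_Vmul corner_unit corner_inv_out.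

Lemma corner_division : division_ring D.
Proof. by []. Qed.

Lemma full_decomposition : exists n (a s : 'I_n -> R),
  [/\ forall i, a i * e = a i, forall i, e * s i = s i,
      1 = \sum_i a i * s i & forall i j, s i * a j = if i == j then e else 0].
Proof.
have [_ ediv [l0 l0E]] := e_full.
pose is_size n := `[< exists2 l : seq (R * R), size l = n &
  1 = \sum_(p <- l) p.1 * e * p.2 >].
have is_size_ex : exists n, is_size n.
  by exists (size l0); apply/asboolP; exists l0.
case: (ex_minnP is_size_ex) => n /asboolP[l ln lE] nmin.
pose a (i : 'I_n) := (nth (0, 0) l i).1 * e.
pose s (i : 'I_n) := e * (nth (0, 0) l i).2.
have ae i : a i * e = a i by rewrite /a -mulrA ee.
have es i : e * s i = s i by rewrite /s mulrA ee.
have as1 : 1 = \sum_i a i * s i.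
  rewrite lE (big_nth (0, 0)) ln big_mkord.
  by apply: eq_bigr => i _; rewrite /a /s mulrA -(mulrA _ e e) ee.
(* Were some [c k] nonzero, hence invertible in eRe, [a k] could be eliminated from the expansion of
   1, against the minimality of [n]. *)
have a_free (c : 'I_n -> R) : (forall i, e * c i * e = c i) ->
    \sum_i a i * c i = 0 -> forall i, c i = 0.
  move=> ec ac0 k; apply/eqP; apply: contrapT => /negP ck0.
  have [|y [_ cy]] := ediv (c k); first by rewrite ec.
  have ak : a k = - \sum_(j | j != k) a j * c j * y.
    move/eqP: ac0; rewrite (bigD1 k) //= addr_eq0 => /eqP ac.
    by rewrite -mulr_suml -mulNr -ac -mulrA -[c k]ec cy ae.
  pose l' := [seq (a j, s j - c j * y * s k) | j <- enum 'I_n & j != k].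
  have : is_size (size l').
    apply/asboolP; exists l' => //.
    rewrite big_map big_filter big_enum_cond /= as1 (bigD1 k) //= {1}ak mulNr.
    rewrite addrC mulr_suml -sumrB; apply: eq_bigr => j _.
    by rewrite ae mulrBr !mulrA.
  move/nmin; rewrite size_map size_filter leqNgt => /negP; apply.
  rewrite -[X in (_ < X)%N](size_enum_ord n) -(count_predC [pred j | j != k]).
  rewrite -[X in (X < _)%N]addn0 ltn_add2l -has_count.
  by apply/hasP; exists k; rewrite ?mem_enum //= negbK.
exists n, a, s; split=> // i j.
(* These are the coefficients of the relation obtained by comparing the expansion of [1 * a j] with
   [a j * e]. *)
pose c k := s k * a j - if k == j then e else 0.
have : c i = 0.
  apply: a_free => [k|].
    rewrite /c mulrBr mulrBl mulrA es -mulrA ae; congr (_ - _).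
    by case: eqP => _; rewrite ?ee // mulr0 mul0r.
  rewrite -[RHS](subrr (a j)) -{1}[a j]mul1r as1 mulr_suml.
  under eq_bigr do rewrite mulrBr mulrA.
  rewrite sumrB; congr (_ - _).
  by rewrite (bigD1 j) //= eqxx ae big1 ?addr0 // => k /negPf->; rewrite mulr0.
by move/eqP; rewrite subr_eq0 => /eqP.
Qed.

(** Inserting [1 = \sum_k a k * s k] makes [r |-> (s i * r * a j)] multiplicative; the orthogonality
    of the [s i] and [a j] gives the inverse. *)
Lemma full_idempotent_matrix :
  exists2 n, (1 <= n)%N & ring_isomorphic R 'M[D]_n.
Proof.
have [n [a [s [ae es as1 sa]]]] := full_decomposition.
exists n.
  case: n a s as1 {ae es sa} => // a s /eqP.
  by rewrite big_ord0 oner_eq0.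
have sra r i j : s i * r * a j \in in_corner.
  by apply/in_cornerP; split; rewrite -mulrA ?ae // !mulrA es.
have [f fE] : exists f : R -> 'M[D]_n,
    forall r i j, val (f r i j) = s i * r * a j.
  exists (fun r => \matrix_(i, j) (Sub (s i * r * a j) (sra r i j) : D)).
  by move=> r i j; rewrite mxE SubK.
have f_add : zmod_morphism f.
  by move=> r t; apply/matrixP => i j; apply: val_inj;
    rewrite fE !mxE raddfB /= !fE mulrBr mulrBl.
have f_mul : monoid_morphism f.
  split=> [|r t]; apply/matrixP => i j; apply: val_inj.
    rewrite fE mulr1 sa !mxE; case: eqP => _; first by rewrite corner_val1.
    by rewrite raddf0.
  have -> : val (f (r * t) i j) = \sum_k s i * r * a k * (s k * t * a j).
    rewrite fE -[r in LHS]mulr1 as1 mulr_sumr mulr_suml mulr_sumr mulr_suml.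
    by apply: eq_bigr => k _; rewrite !mulrA.
  rewrite mxE raddf_sum; apply: eq_bigr => k _.
  by rewrite -[RHS]/(val (f r i k) * val (f t k j)) !fE.
pose fa := GRing.isZmodMorphism.Build R 'M[D]_n f f_add.
pose fm := GRing.isMonoidMorphism.Build R 'M[D]_n f f_mul.
pose F : {rmorphism R -> 'M[D]_n} :=
  HB.pack_for {rmorphism R -> 'M[D]_n} f fa fm.
exists F; exists (fun X : 'M[D]_n => \sum_i \sum_j a i * val (X i j) * s j).
  move=> r /=; rewrite -[RHS]mul1r as1 mulr_suml; apply: eq_bigr => i _.
  rewrite -[RHS]mulr1 [in RHS]as1 mulr_sumr; apply: eq_bigr => j _.
  by rewrite fE !mulrA.
move=> X; apply/matrixP => i j; apply: val_inj; rewrite fE.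
have [eX Xe] := cornerP (X i j).
rewrite mulr_sumr mulr_suml (bigD1 i) //= [X in _ + X]big1 ?addr0 => [|k ki].
  rewrite mulr_sumr mulr_suml (bigD1 j) //= [X in _ + X]big1 ?addr0 => [|l lj].
    by rewrite !mulrA sa eqxx -mulrA sa eqxx eX Xe.
  by rewrite -!mulrA sa (negPf lj) !mulr0.
rewrite mulr_sumr mulr_suml big1 // => l _.
by rewrite !mulrA sa eq_sym (negPf ki) !mul0r.
Qed.

End Corner.

(** * Idempotents of matrix rings and the equivalences *)

Lemma delta_mx_sandwich (D : pzRingType) n (i j k l : 'I_n) (X : 'M[D]_n) :
  delta_mx i j *m X *m delta_mx k l = X j k *: delta_mx i l.
Proof.
apply/matrixP => p q; rewrite !mxE (bigD1 k) //= [X in _ + X]big1 ?addr0.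
  rewrite !mxE (bigD1 j) //= [X in _ + X]big1 ?addr0.
    rewrite !mxE !eqxx !andbT /=; case: eqP => _; case: eqP => _ //=;
      by rewrite ?(mul1r, mul0r, mulr1, mulr0).
  by move=> m mj; rewrite !mxE (negPf mj) andbF mul0r.
by move=> m mk; rewrite !mxE (negPf mk) mulr0.
Qed.

(** The idempotent is the matrix unit at (0, 0): its corner is a copy of [D], and 1 is the sum of
    the products of the units at (i, 0), (0, 0) and (0, i). *)
Lemma matrix_full_idempotent (R : nzRingType) (D : unitRingType) n :
  division_ring D -> (1 <= n)%N -> ring_isomorphic R 'M[D]_n ->
  exists e : R, full_division_idempotent e.
Proof.
case: n => // n divD _ [f [g fK gK]]; have f_inj := can_inj fK.
pose E : 'M[D]_n.+1 := delta_mx 0 0.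
have EXE X : E * X * E = X 0 0 *: E by exact: delta_mx_sandwich.
have EE : E * E = E by exact: mul_delta_mx.
exists (g E); split.
- by apply: f_inj; rewrite rmorphM gK.
- move=> x; rewrite -(inj_eq f_inj) rmorph0 !rmorphM gK EXE => xE0.
  have x0 : f x 0 0 \is a GRing.unit.
    by apply: divD; apply: contraNneq xE0 => ->; rewrite scale0r.
  pose Y := (f x 0 0)^-1 *: E.
  have EY : E * Y = Y.
    have EYE : E * Y * E = Y by rewrite EXE !mxE eqxx mulr1.
    by rewrite -{1}EYE !mulrA EE EYE.
  exists (g Y); split; apply: f_inj; rewrite !rmorphM !gK EXE.
    rewrite -[Y * _]/(Y *m _) -scalemxAl -[E *m _]/(E * _) -EXE !mulrA EE EXE.
    by rewrite scalerA mulVr // scale1r.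
  rewrite -[_ * Y]/(_ *m Y) -scalemxAl -[E *m _]/(E * _) EY.
  by rewrite scalerA mulrV // scale1r.
exists [seq (g (delta_mx i 0), g (delta_mx 0 i)) | i <- enum 'I_n.+1].
apply: f_inj; rewrite rmorph1 rmorph_sum /= big_map big_enum /=.
rewrite -[1]/(1%:M) mx1_sum_delta; apply: eq_bigr => i _.
by rewrite !rmorphM !gK -[RHS]/(_ *m _ *m _) !mul_delta_mx.
Qed.

Lemma full_division_idempotent_weakly_uniserial (R : nzRingType) (e : R) :
  full_division_idempotent e -> forall M : lmodType R, weakly_uniserial M.
Proof. by move=> e_full M P Q N K; exact: simple_isotypic_embed e_full. Qed.

Lemma weakly_uniserial_of_injective (R : nzRingType) :
  (forall M : lmodType R, injective_module M -> weakly_uniserial M) ->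
  forall M : lmodType R, weakly_uniserial M.
Proof.
move=> wu_inj M P Q N K; have [E [f [E_inj f_inj]]] := enough_injectives M.
apply: (weakly_uniserial_embed (f := f \o (val : N -> M))
  (g := f \o (val : K -> M)) (wu_inj _ E_inj));
  apply: (inj_comp f_inj); exact: val_inj.
Qed.

Theorem theorem3p5 (R : nzRingType) :
  [<-> (* (a) *)
       exists (D : unitRingType) (n : nat),
         [/\ division_ring D, (1 <= n)%N & ring_isomorphic R 'M[D]_n];
       (* (b)-(e), right modules *)
       forall M : lmodType R^c, weakly_uniserial M;
       forall M : lmodType R^c, finitely_generated M -> weakly_uniserial M;
       forall M : lmodType R^c, n_generated 2 M -> weakly_uniserial M;
       forall M : lmodType R^c, injective_module M -> weakly_uniserial M;
       (* (f), left modules *)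
       forall M : lmodType R, weakly_uniserial M;
       forall M : lmodType R, finitely_generated M -> weakly_uniserial M;
       forall M : lmodType R, n_generated 2 M -> weakly_uniserial M;
       forall M : lmodType R, injective_module M -> weakly_uniserial M].
Proof.
have right_full :
    (forall M : lmodType R^c, n_generated 2 M -> weakly_uniserial M) ->
    exists e : R, full_division_idempotent e.
  move=> /full_division_idempotent_exists[e /full_division_idempotentC].
  by exists e.
have right_wu (e : R) : full_division_idempotent e ->
    forall M : lmodType R^c, weakly_uniserial M.
  move=> e_full; apply: (@full_division_idempotent_weakly_uniserial R^c e).
  exact: (@full_division_idempotentC R^c).
(* The implications form one cycle: (e) for right modules passes to left modules through the
   idempotent, and (e) for left modules leads back to (a). *)
tfae.
- move=> [D [n [divD n1 R_iso]]].
  have [e /right_wu//] := matrix_full_idempotent divD n1 R_iso.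
- by move=> wu M _; exact: wu.
- by move=> wu M M2; apply: wu; exists 2.
- by move=> /right_full[e /right_wu wu] M _; exact: wu.
- move=> wu_inj; have wu := weakly_uniserial_of_injective wu_inj.
  have [|e] := right_full; first by move=> M _; exact: wu.
  exact: full_division_idempotent_weakly_uniserial.
- by move=> wu M _; exact: wu.
- by move=> wu M M2; apply: wu; exists 2.
- move=> /full_division_idempotent_exists[e e_full] M _.
  exact: full_division_idempotent_weakly_uniserial e_full M.
- move=> wu_inj; have wu := weakly_uniserial_of_injective wu_inj.
  have [|e e_full] := @full_division_idempotent_exists R.
    by move=> M _; exact: wu.
  have [n n1 R_iso] := full_idempotent_matrix e_full.
  by exists (corner e_full), n; split=> //; exact: corner_division.
Qed.
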